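(* Let $\mathcal G$ be a locally compact Hausdorff groupoid with unit space $\mathcal G^{(0)}$, let $\Gamma$ be a discrete group with identity $e$, and let $c:\mathcal G\to\Gamma$ be a continuous cocycle. Then $c$ is injective on each isotropy group $\mathcal G_u^u$, $u\in\mathcal G^{(0)}$, if and only if the identity fibre $\mathcal G_e:=c^{-1}(e)$ is a principal groupoid. In particular, if these equivalent conditions hold (and $\mathcal G$ is ample), then $c^{-1}(e)$ is strongly effective.
   Context: A cocycle is a groupoid homomorphism. For a groupoid $\mathcal G$ with range map $r$ and source map $s$, the isotropy group at $u\in\mathcal G^{(0)}$ is $\mathcal G_u^u=\{\gamma:r(\gamma)=s(\gamma)=u\}$. A groupoid is principal if all its isotropy groups are trivial. $\mathcal G$ is ample if it is étale and has a basis of compact open bisections (sets on which $r$ and $s$ are injective). A set $C\subseteq\mathcal G^{(0)}$ is invariant if $r(s^{-1}(C))=C$, and then $\mathcal G|_C=s^{-1}(C)\cap r^{-1}(C)$. A groupoid is effective if the interior of $\mathrm{Iso}(\mathcal G)=\{g:r(g)=s(g)\}$ equals $\mathcal G^{(0)}$; it is strongly effective if its restriction to every closed invariant subset of the unit space is effective (restrictions carry the subspace topology). *)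

(* Defs.v *)
From HB Require Import structures.
From mathcomp Require Import all_boot.
From mathcomp Require Import all_classical topology.

Set Implicit Arguments.
Unset Strict Implicit.
Unset Printing Implicit Defensive.

Local Open Scope classical_set_scope.

(* A groupoid is given by its arrows; units are identified with identity     *)
(* arrows, so that the range and source maps take values in arrows.  The     *)
(* product [gmul g h] is meaningful only when [gsrc g = grng h] and is an    *)
(* unconstrained junk value otherwise.                                       *)
HB.mixin Record isGroupoid G := {
  grng : G -> G;
  gsrc : G -> G;
  ginv : G -> G;
  gmul : G -> G -> G;
  grng_rng : forall g, grng (grng g) = grng g;
  gsrc_rng : forall g, gsrc (grng g) = grng g;
  grng_src : forall g, grng (gsrc g) = gsrc g;
  gsrc_src : forall g, gsrc (gsrc g) = gsrc g;
  grng_mul : forall g h, gsrc g = grng h -> grng (gmul g h) = grng g;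
  gsrc_mul : forall g h, gsrc g = grng h -> gsrc (gmul g h) = gsrc h;
  gmulA : forall g h k, gsrc g = grng h -> gsrc h = grng k ->
    gmul g (gmul h k) = gmul (gmul g h) k;
  gmul_rng : forall g, gmul (grng g) g = g;
  gmul_src : forall g, gmul g (gsrc g) = g;
  grng_inv : forall g, grng (ginv g) = gsrc g;
  gsrc_inv : forall g, gsrc (ginv g) = grng g;
  gmul_invr : forall g, gmul g (ginv g) = grng g;
  gmul_invl : forall g, gmul (ginv g) g = gsrc g
}.

#[short(type="groupoidType")]
HB.structure Definition Groupoid := {G of isGroupoid G}.

(* Continuity of [grng] and [gsrc] is a consequence, see [gmul_invr] and     *)
(* [gmul_invl].                                                              *)
HB.mixin Record Groupoid_isTopological G of Groupoid G & Topological G := {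
  ginv_continuous : continuous (@ginv G);
  gmul_continuous :
    {within [set p : G * G | gsrc p.1 = grng p.2],
      continuous (fun p : G * G => gmul p.1 p.2)}
}.

#[short(type="topologicalGroupoidType")]
HB.structure Definition TopologicalGroupoid :=
  {G of Groupoid G & Topological G & Groupoid_isTopological G}.

Section AlgebraicNotions.
Context {G : groupoidType}.

Definition isotropy (u : G) : set G := [set g | grng g = u /\ gsrc g = u].

Definition bisection (B : set G) : Prop :=
  {in B &, injective (@grng G)} /\ {in B &, injective (@gsrc G)}.

Definition subgroupoid_closed (H : set G) : Prop :=
  (forall g, H g -> H (ginv g)) /\
  (forall g h, gsrc g = grng h -> H g -> H h -> H (gmul g h)).

End AlgebraicNotions.

Definition units (G : groupoidType) : set G := range (@grng G).
Arguments units : clear implicits.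

Definition Iso (G : groupoidType) : set G := [set g | grng g = gsrc g].
Arguments Iso : clear implicits.

Definition principal (G : groupoidType) : Prop :=
  forall u : G, units G u -> isotropy u = [set u].

Definition invariant (G : groupoidType) (C : set G) : Prop :=
  C `<=` units G /\ @grng G @` (@gsrc G @^-1` C) = C.

Definition cocycle (G : groupoidType) (Gamma : groupType) (c : G -> Gamma) :=
  forall g h, gsrc g = grng h -> c (gmul g h) = (c g * c h)%g.

(* The subgroupoid on [H], with the subspace topology when [G] is            *)
(* topological.                                                              *)
Definition subgroupoid (G : groupoidType) (H : set G)
  (HH : subgroupoid_closed H) : Type := set_type H.

Section Subgroupoid.
Context {G : groupoidType} {H : set G} (HH : subgroupoid_closed H).
Local Notation S := (subgroupoid HH).

Let inH (x : set_type H) : H (val x).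
Proof. exact: set_mem (valP x). Qed.

Fact subgroupoid_inv g : H g -> H (ginv g).
Proof. by case: HH => + _; apply. Qed.

Fact subgroupoid_mul g h : gsrc g = grng h -> H g -> H h -> H (gmul g h).
Proof. by case: HH => _; apply. Qed.

Fact subgroupoid_rng g : H g -> H (grng g).
Proof.
move=> Hg; rewrite -gmul_invr; apply: subgroupoid_mul => //.
- by rewrite grng_inv.
- exact: subgroupoid_inv.
Qed.

Fact subgroupoid_src g : H g -> H (gsrc g).
Proof.
move=> Hg; rewrite -gmul_invl; apply: subgroupoid_mul => //.
- by rewrite gsrc_inv.
- exact: subgroupoid_inv.
Qed.

Definition sub_rng (x : S) : S :=
  exist _ (grng (val x)) (mem_set (subgroupoid_rng (inH x))).
Definition sub_src (x : S) : S :=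
  exist _ (gsrc (val x)) (mem_set (subgroupoid_src (inH x))).
Definition sub_inv (x : S) : S :=
  exist _ (ginv (val x)) (mem_set (subgroupoid_inv (inH x))).
(* The product computed in [G] if it lies in [H], which is the case for      *)
(* composable pairs (see [val_sub_mul]), and the junk value [x] otherwise.   *)
Definition sub_mul (x y : S) : S :=
  insubd (x : set_type H) (gmul (val x) (val y)).

Fact sub_composable (x y : S) :
  sub_src x = sub_rng y -> gsrc (val x) = grng (val y).
Proof. by move=> /(congr1 val). Qed.

Fact val_sub_mul (x y : S) : gsrc (val x) = grng (val y) ->
  val (sub_mul x y) = gmul (val x) (val y).
Proof.
move=> xy; rewrite /sub_mul insubdK//; apply/mem_set.
by apply: subgroupoid_mul => //; exact: inH.
Qed.

Fact sub_rng_rng x : sub_rng (sub_rng x) = sub_rng x.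
Proof. by apply: val_inj; exact: grng_rng. Qed.
Fact sub_src_rng x : sub_src (sub_rng x) = sub_rng x.
Proof. by apply: val_inj; exact: gsrc_rng. Qed.
Fact sub_rng_src x : sub_rng (sub_src x) = sub_src x.
Proof. by apply: val_inj; exact: grng_src. Qed.
Fact sub_src_src x : sub_src (sub_src x) = sub_src x.
Proof. by apply: val_inj; exact: gsrc_src. Qed.
Fact sub_rng_mul x y : sub_src x = sub_rng y -> sub_rng (sub_mul x y) = sub_rng x.
Proof.
move=> /sub_composable xy; apply: val_inj.
by rewrite /= val_sub_mul// grng_mul.
Qed.
Fact sub_src_mul x y : sub_src x = sub_rng y -> sub_src (sub_mul x y) = sub_src y.
Proof.
move=> /sub_composable xy; apply: val_inj.
by rewrite /= val_sub_mul// gsrc_mul.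
Qed.
Fact sub_mulA x y z : sub_src x = sub_rng y -> sub_src y = sub_rng z ->
  sub_mul x (sub_mul y z) = sub_mul (sub_mul x y) z.
Proof.
move=> /sub_composable xy /sub_composable yz; apply: val_inj.
by rewrite !val_sub_mul ?grng_mul ?gsrc_mul// gmulA.
Qed.
Fact sub_mul_rng x : sub_mul (sub_rng x) x = x.
Proof. by apply: val_inj; rewrite val_sub_mul/= ?gmul_rng ?gsrc_rng. Qed.
Fact sub_mul_src x : sub_mul x (sub_src x) = x.
Proof. by apply: val_inj; rewrite val_sub_mul/= ?gmul_src ?grng_src. Qed.
Fact sub_rng_inv x : sub_rng (sub_inv x) = sub_src x.
Proof. by apply: val_inj; exact: grng_inv. Qed.
Fact sub_src_inv x : sub_src (sub_inv x) = sub_rng x.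
Proof. by apply: val_inj; exact: gsrc_inv. Qed.
Fact sub_mul_invr x : sub_mul x (sub_inv x) = sub_rng x.
Proof. by apply: val_inj; rewrite val_sub_mul/= ?gmul_invr ?grng_inv. Qed.
Fact sub_mul_invl x : sub_mul (sub_inv x) x = sub_src x.
Proof. by apply: val_inj; rewrite val_sub_mul/= ?gmul_invl ?gsrc_inv. Qed.

HB.instance Definition _ := isGroupoid.Build S
  sub_rng_rng sub_src_rng sub_rng_src sub_src_src sub_rng_mul sub_src_mul
  sub_mulA sub_mul_rng sub_mul_src sub_rng_inv sub_src_inv
  sub_mul_invr sub_mul_invl.

End Subgroupoid.

Section TopologicalSubgroupoid.
Context {G : topologicalGroupoidType} {H : set G} (HH : subgroupoid_closed H).
Local Notation S := (subgroupoid HH).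

HB.instance Definition _ := Topological.copy S (set_type H).

Fact sub_val_continuous : continuous (val : S -> G).
Proof. exact: (@initial_continuous (set_type H) G set_val). Qed.

(* A map into the subspace is continuous as soon as it is so into [G].       *)
Fact sub_cvg (F : set_system S) (x : S) : Filter F ->
  (val : S -> G) @ F --> val x -> F --> x.
Proof.
move=> FF Fx U [_ [[V oV <-] Vx] VU].
apply: (filterS VU).
by apply: Fx; exact: open_nbhs_nbhs.
Qed.

Fact sub_inv_continuous : continuous (@ginv S).
Proof.
move=> x; apply: (sub_cvg (fmap_filter (@ginv S) (@nbhs_filter S x))) => U /ginv_continuous.
exact: (@sub_val_continuous x).
Qed.

Fact sub_mul_continuous :
  {within [set p : S * S | gsrc p.1 = grng p.2],
    continuous (fun p : S * S => gmul p.1 p.2)}.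
Proof.
apply/subspace_continuousP => -[x y] /= xy.
set F := within _ _; have FF : Filter F by exact: within_filter.
apply: (sub_cvg (fmap_filter _ FF)) => U /=.
rewrite val_sub_mul; last exact: sub_composable.
have /subspace_continuousP := @gmul_continuous G.
move=> /(_ (val x, val y) (sub_composable xy)) /[apply].
case=> -[A B] [/= Ax By] ABU.
exists ((val : S -> G) @^-1` A, (val : S -> G) @^-1` B).
  by split=> /=; exact: sub_val_continuous.
move=> [x' y'] [/= Ax' By'] xy'.
rewrite /= val_sub_mul; last exact: sub_composable.
by apply: (ABU (val x', val y')) => //; exact: sub_composable.
Qed.

HB.instance Definition _ := Groupoid_isTopological.Build S
  sub_inv_continuous sub_mul_continuous.

End TopologicalSubgroupoid.

Section IdentityFibre.
Context {G : groupoidType} {Gamma : groupType} {c : G -> Gamma}.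
Hypothesis hc : cocycle c.

Fact cocycle_rng g : c (grng g) = 1%g.
Proof.
have /hc : gsrc (grng g) = grng (grng g) by rewrite gsrc_rng grng_rng.
rewrite -[X in gmul X _]grng_rng gmul_rng.
by rewrite -{1}[c _]mulg1 => /mulgI.
Qed.

Fact cocycle_fibre_closed : subgroupoid_closed (c @^-1` [set 1%g]).
Proof.
split=> [g /= cg|g h gh /= cg ch]; last by rewrite hc// cg ch mulg1.
by rewrite -[LHS]mul1g -cg -hc ?grng_inv// gmul_invr cocycle_rng.
Qed.

End IdentityFibre.

Definition identity_fibre (G : topologicalGroupoidType) (Gamma : groupType)
    (c : G -> Gamma) (hc : cocycle c) : topologicalGroupoidType :=
  subgroupoid (cocycle_fibre_closed hc).

Fact restriction_closed (G : groupoidType) (C : set G) :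
  subgroupoid_closed (@gsrc G @^-1` C `&` @grng G @^-1` C).
Proof.
split=> [g [Cs Cr]|g h gh [Cs Cr] [Cs' Cr']]; split=> /=.
- by rewrite gsrc_inv.
- by rewrite grng_inv.
- by rewrite gsrc_mul.
- by rewrite grng_mul.
Qed.

Definition restriction (G : topologicalGroupoidType) (C : set G) :
  topologicalGroupoidType := subgroupoid (restriction_closed C).

Definition local_homeomorphism (X Y : topologicalType) (f : X -> Y) : Prop :=
  forall x, exists U : set X,
    [/\ open U /\ U x,
        {in U &, injective f},
        {within U, continuous f} &
        forall V, open V -> V `<=` U -> open (f @` V)].

(* [subspace (units G)] makes every point outside [units G] isolated; as     *)
(* [grng] and [gsrc] take values in units, these are local homeomorphisms    *)
(* onto open subsets of the unit space with its subspace topology.           *)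
Definition etale (G : topologicalGroupoidType) : Prop :=
  local_homeomorphism (@grng G : G -> subspace (units G)) /\
  local_homeomorphism (@gsrc G : G -> subspace (units G)).

Definition ample (G : topologicalGroupoidType) : Prop :=
  etale G /\
  exists2 B : set (set G), basis B &
    forall U, B U -> [/\ compact U, open U & bisection U].

Definition effective (G : topologicalGroupoidType) : Prop :=
  interior (Iso G) = units G.

(* [C] is closed relatively to the unit space.                               *)
Definition strongly_effective (G : topologicalGroupoidType) : Prop :=
  forall C : set G, invariant C -> closed (C : set (subspace (units G))) ->
    effective (restriction C).

(* Main.v *)
Require Import Defs.
From mathcomp Require Import all_boot.
From mathcomp Require Import all_classical topology.
Local Open Scope classical_set_scope.

(** The isotropy of the identity fibre at a unit [u] is the kernel of the
    homomorphism obtained by restricting [c] to the isotropy group of [G] at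
    [u]; hence one direction of the equivalence is that an injective
    homomorphism has trivial kernel, and the other that a homomorphism with
    trivial kernel is injective ([principal_identity_fibreP]).

    For the consequence, a principal groupoid satisfies [Iso G = units G], so
    it is effective as soon as its unit space is open
    ([principal_open_units_effective]).  Both properties pass from a groupoid
    to its subgroupoids ([principal_subgroupoid], [open_units_subgroupoid]),
    in particular to the restriction of the identity fibre to a set of units.
    The first one holds in the identity fibre by the equivalence, and the
    second one holds in [G] because [G] is etale ([etale_open_units]). *)

Section Units.
Context {G : groupoidType}.
Implicit Types g h u : G.

Lemma grng_unit u : units G u -> grng u = u.
Proof. by case=> g _ <-; exact: grng_rng. Qed.

Lemma gsrc_unit u : units G u -> gsrc u = u.
Proof. by case=> g _ <-; exact: gsrc_rng. Qed.

Lemma isotropy_unit u : units G u -> isotropy u u.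
Proof. by move=> uu; split; [exact: grng_unit|exact: gsrc_unit]. Qed.

Lemma units_sub_Iso : units G `<=` Iso G.
Proof. by move=> u uu; rewrite /Iso /= grng_unit// gsrc_unit. Qed.

Lemma principal_Iso : principal G -> Iso G = units G.
Proof.
move=> pG; apply/seteqP; split; last exact: units_sub_Iso.
move=> g /= rs; have rgu : units G (grng g) by exists g.
suff : isotropy (grng g) g by rewrite pG// => ->.
by split.
Qed.

Lemma eq_of_mul_inv_rng g h : gsrc g = gsrc h ->
  gmul g (ginv h) = grng h -> g = h.
Proof.
move=> gh ghV.
by rewrite -(gmul_src g) gh -gmul_invl gmulA ?grng_inv ?gsrc_inv// ghV gmul_rng.
Qed.

End Units.

Section Subgroupoids.
Context {G : groupoidType} {H : set G} (HH : subgroupoid_closed H).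

Lemma units_subgroupoid :
  units (subgroupoid HH) = (val : subgroupoid HH -> G) @^-1` units G.
Proof.
apply/seteqP; split=> [_ [x _ <-]|x ux]; first by exists (val x).
by exists x => //; apply: val_inj; exact: grng_unit ux.
Qed.

Lemma isotropy_subgroupoid (u : subgroupoid HH) :
  isotropy u = (val : subgroupoid HH -> G) @^-1` isotropy (val u).
Proof.
apply/seteqP; split=> x [/= xr xs]; last by split; exact: val_inj.
by split; [exact: (congr1 val xr)|exact: (congr1 val xs)].
Qed.

Lemma principal_subgroupoid : principal G -> principal (subgroupoid HH).
Proof.
move=> pG u; rewrite units_subgroupoid => uu.
rewrite isotropy_subgroupoid pG//; apply/seteqP; split=> x /=.
  exact: val_inj.
by move=> ->.
Qed.

End Subgroupoids.

Lemma open_units_subgroupoid (G : topologicalGroupoidType) (H : set G)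
    (HH : subgroupoid_closed H) :
  open (units G) -> open (units (subgroupoid HH)).
Proof.
move=> oG; rewrite units_subgroupoid; apply: open_comp => // x _.
exact: sub_val_continuous.
Qed.

Lemma principal_identity_fibreP (G : topologicalGroupoidType)
    (Gamma : groupType) (c : G -> Gamma) (hc : cocycle c) :
  (forall u : G, units G u -> {in isotropy u &, injective c}) <->
  principal (identity_fibre hc).
Proof.
split=> [cI u|pH u uu g h /set_mem[gr gs] /set_mem[hr hs] cgh].
  rewrite units_subgroupoid => uu; rewrite isotropy_subgroupoid.
  apply/seteqP; split=> [x xu|_ ->]; last exact: isotropy_unit.
  apply: val_inj; apply: (cI _ uu); rewrite ?inE//; first exact: isotropy_unit.
  by rewrite (set_mem (valP x)) (set_mem (valP u)).
have ghV : gsrc g = grng (ginv h) by rewrite grng_inv gs hs.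
have cu : c u = 1%g by rewrite -hr cocycle_rng.
have ck : c (gmul g (ginv h)) = 1%g.
  by rewrite hc// cgh -hc ?grng_inv// gmul_invr cocycle_rng.
pose k : identity_fibre hc := exist _ (gmul g (ginv h)) (mem_set ck).
pose v : identity_fibre hc := exist _ u (mem_set cu).
have vu : units (identity_fibre hc) v by rewrite units_subgroupoid.
have : isotropy v k.
  rewrite isotropy_subgroupoid; split=> /=; first by rewrite grng_mul.
  by rewrite gsrc_mul// gsrc_inv.
rewrite pH// => /(congr1 val)/= kv.
by apply: eq_of_mul_inv_rng; rewrite ?gs ?hs ?hr.
Qed.

(** If [r] is injective on a neighbourhood [U] of a unit, then every [x] in
    [U] with [r x] in [U] is equal to [r x], because [r] takes the same value
    at both; by continuity of [r] such [x] form a neighbourhood. *)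
Lemma etale_open_units (G : topologicalGroupoidType) :
  etale G -> open (units G).
Proof.
case=> rloc _; rewrite openE => u uu.
have [U [[oU Uu] rinj rcont _]] := rloc u.
have nU : nbhs u U by exact: open_nbhs_nbhs.
have nrU : nbhs u [set x | U (grng x)].
  have : nbhs (grng u : subspace (units G)) U.
    rewrite grng_unit// /nbhs /= -nbhs_subspace_in//.
    exact: (@cvg_within _ (nbhs u) _ (units G) U nU).
  move: rcont => /(_ u) /[apply].
  by rewrite /= (nbhs_subspace_interior (A := U)) ?interior_id.
apply: filterS (filterI nU nrU) => x [Ux Urx].
by exists x => //; apply: rinj; rewrite ?inE ?grng_rng.
Qed.

Lemma principal_open_units_effective (G : topologicalGroupoidType) :
  principal G -> open (units G) -> effective G.
Proof.
by move=> pG oG; rewrite /effective principal_Iso//; apply/interior_id.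
Qed.

Theorem proposition4p13 (G : topologicalGroupoidType) (Gamma : groupType)
    (c : G -> Gamma) (hlc : locally_compact [set: G])
    (hT2 : hausdorff_space G) (hc : cocycle c)
    (hcont : continuous (c : G -> discrete_topology Gamma)) :
  ((forall u : G, units G u -> {in isotropy u &, injective c}) <->
     principal (identity_fibre hc)) /\
  (ample G ->
     (forall u : G, units G u -> {in isotropy u &, injective c}) ->
     strongly_effective (identity_fibre hc)).
Proof.
split; first exact: principal_identity_fibreP.
move=> [eG _] /principal_identity_fibreP pH C _ _.
apply: principal_open_units_effective; first exact: principal_subgroupoid.
by do 2 apply: open_units_subgroupoid; exact: etale_open_units.
Qed.
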